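(* There is an absolute constant $c>0$ such that the following holds. Let $n\ge1$, $k\ge2$, and let $\nu$ be a sub-distribution on $[k]$. Let $\Pi$ be a deterministic $[c_1,\ldots,c_k]$-bounded $k$-party protocol which solves unique set-disjointness under input distribution $\mathcal{D}_\nu$ with error at most $2\%$. Then $\sum_{i\in[k]} c_i/\nu(i)\ge c\,n$ (with conventions $0/0=0$, $a/0=+\infty$ for $a>0$).
   Context: A sub-distribution $\nu$ on $[k]$ satisfies $\nu(i)\ge0$ and $\sum_i\nu(i)\le1$. Inputs are $X=(X_1,\ldots,X_k)\in(\{0,1\}^n)^k$; $X^j=(X_1(j),\ldots,X_k(j))$; $\mathcal{F}_0=\{X:\forall j,|X^j|\le1\}$, $\mathcal{F}_1=\{X:\exists j,|X^j|=k,\forall j'\ne j,|X^{j'}|\le1\}$, correct output $b$ on $\mathcal{F}_b$. $\mathcal{D}^0_\nu$: independently for each $j\in[n]$, with probability $\nu(i)$ (for each $i$) let $X_i(j)$ be a uniform bit and $X_{i'}(j)=0$ for $i'\ne i$, and with probability $1-\sum_i\nu(i)$ set $X^j=0^k$. $\mathcal{D}^1_\nu$: sample $X\sim\mathcal{D}^0_\nu$ and a uniform $j^*\in[n]$ and set $X^{j^*}=1^k$. $\mathcal{D}_\nu$: uniform bit $b$, then $X\sim\mathcal{D}^b_\nu$. Protocols are in the blackboard model; $[c_1,\ldots,c_k]$-bounded means player $i$ writes at most $c_i$ bits in every transcript; error under $\mathcal{D}_\nu$ is the probability the output differs from $b$. *)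

(* Defs.v *)
From HB Require Import structures.
From mathcomp Require Import all_boot all_order all_algebra.
From mathcomp Require Import constructive_ereal Rstruct.
Notation R := Rdefinitions.R.
Set Implicit Arguments. Unset Strict Implicit. Unset Printing Implicit Defensive.
Import Order.TTheory GRing.Theory Num.Theory.
Local Open Scope ring_scope.

Definition BV (n : nat) := {ffun 'I_n -> bool}.
Definition Input (k n : nat) := {ffun 'I_k -> BV n}.

Definition subdistr (k : nat) (nu : 'I_k -> R) : Prop :=
  (forall i, 0 <= nu i) /\ \sum_(i < k) nu i <= 1.

Definition single_col (k : nat) (i : 'I_k) (b : bool) : {ffun 'I_k -> bool} :=
  [ffun i' => (i' == i) && b].

Definition col_prob (k : nat) (nu : 'I_k -> R) (col : {ffun 'I_k -> bool}) : R :=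
  (1 - \sum_(i < k) nu i) * (col == [ffun=> false])%:R
  + \sum_(i < k) nu i * \sum_(b : bool) 2^-1 * (col == single_col i b)%:R.

Definition column (k n : nat) (X : Input k n) (j : 'I_n) : {ffun 'I_k -> bool} :=
  [ffun i => X i j].

Definition D0 (k n : nat) (nu : 'I_k -> R) (X : Input k n) : R :=
  \prod_(j < n) col_prob nu (column X j).

Definition set_col (k n : nat) (X : Input k n) (js : 'I_n) : Input k n :=
  [ffun i => [ffun j => (j == js) || X i j]].

Definition D1 (k n : nat) (nu : 'I_k -> R) (Y : Input k n) : R :=
  \sum_(X : Input k n) \sum_(js < n)
     D0 nu X * n%:R^-1 * (Y == set_col X js)%:R.

(* Deterministic blackboard protocols, bit by bit: at each node the
   designated player i (determined by the board content so far, i.e. the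
   position in the tree) writes a bit that is a function of X_i; leaves are
   labelled by the output. *)
Inductive protocol (k n : nat) : Type :=
| Leaf of bool
| Node of 'I_k & (BV n -> bool) & protocol k n & protocol k n.
  (* Node i f t0 t1 : player i writes f X_i; continue in t0 (bit 0) or t1 (bit 1). *)

Fixpoint run (k n : nat) (t : protocol k n) (X : Input k n) : bool :=
  match t with
  | Leaf b => b
  | Node i f t0 t1 => if f (X i) then run t1 X else run t0 X
  end.

Fixpoint bits_written (k n : nat) (i : 'I_k) (t : protocol k n) (X : Input k n) : nat :=
  match t with
  | Leaf _ => 0
  | Node i' f t0 t1 =>
      ((i' == i) : nat) + bits_written i (if f (X i') then t1 else t0) X
  end.

Definition bounded (k n : nat) (c : 'I_k -> nat) (t : protocol k n) : Prop :=
  forall (X : Input k n) (i : 'I_k), leq (bits_written i t X) (c i).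

Definition error (k n : nat) (nu : 'I_k -> R) (t : protocol k n) : R :=
  2^-1 * \sum_(X : Input k n) D0 nu X * (run t X != false)%:R
  + 2^-1 * \sum_(X : Input k n) D1 nu X * (run t X != true)%:R.

Definition cost_ratio (k : nat) (c : 'I_k -> nat) (nu : 'I_k -> R) (i : 'I_k) : \bar R :=
  if nu i == 0 then (if c i == 0%N then 0%E else +oo%E)
  else ((c i)%:R / nu i)%:E.

(* Main.v *)
(* Reveal for each coordinate [j] the player [D j], if any, who holds the free
   bit; given [D] the inputs of the players are independent, so every leaf has
   probability [\prod_i mass D i].  Writing [T_v] for the transcript distribution
   when column [j] is [v], let [loss D j i] be the squared Hellinger distance of
   [T_0] and [T_{e_i}].
   - Player [i] writes at most [c_i] bits, so by Kraft's inequality and the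
     level-one inequality the losses over [{j | D j = Some i}] sum to at most
     [8 c_i]; averaging over [D] turns this into
     [\sum_j E loss D j i <= 8 c_i / nu i].
   - [h^2(T_0, T_{1^k}) <= 4 \sum_i h^2(T_0, T_{e_i})], following Jayram's
     cut-and-paste argument.
   - A small error forces [h^2(T_0, T_{1^k})] to be bounded below on average. *)

Require Import Defs.
From mathcomp Require Import all_boot all_order all_algebra.
From mathcomp Require Import constructive_ereal Rstruct.
From mathcomp Require Import ring lra.
From Stdlib Require Import Rtrigo_def Rpower.
Set Implicit Arguments.
Unset Strict Implicit.
Unset Printing Implicit Defensive.
Import Order.TTheory GRing.Theory Num.Theory.
Local Open Scope ring_scope.

(** * Hellinger distance: from one joint switch to single-player switches *)

(** A substitute for the derivative at [p = 0]: the remainder is quadratic, with [K] independent of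
    [p]. *)
Lemma prod_affine_taylor (F : realFieldType) (I : eqType) (r : seq I)
    (x y : I -> F) : uniq r ->
  exists2 K, 0 <= K & forall p, 0 <= p <= 1 ->
    `|\prod_(i <- r) (x i + p * y i) - \prod_(i <- r) x i
      - p * \sum_(i <- r) y i * \prod_(j <- r | j != i) x j| <= K * p ^+ 2.
Proof.
elim: r => [_|i r IH /=/andP[ir ur]].
  exists 0 => // p _; by rewrite !big_nil mulr0 subrr subr0 normr0 mul0r.
have [K K0 HK] := IH ur.
set S := \sum_(i <- r) y i * \prod_(j <- r | j != i) x j in HK.
set P := \prod_(i <- r) x i in HK.
exists (`|x i| * K + `|y i| * `|S| + `|y i| * K) => [|p p01].
  by rewrite !addr_ge0 ?mulr_ge0.
have -> : \sum_(i0 <- i :: r) y i0 * \prod_(j <- i :: r | j != i0) x j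
    = y i * P + x i * S.
  rewrite big_cons big_cons eqxx /=; congr (_ * _ + _).
    rewrite big_seq_cond [RHS]big_seq; apply: eq_bigl => j.
    by case: (boolP (j \in r)) => //= jr; apply: contraNneq ir => <-.
  rewrite mulr_sumr [LHS]big_seq [RHS]big_seq; apply: eq_bigr => j jr.
  rewrite big_cons ifT 1?mulrCA //.
  by apply: contraNneq ir => ->.
rewrite !big_cons -/P.
have := HK p p01; set E := _ - _ - _ => HE.
have -> : (x i + p * y i) * \prod_(j <- r) (x j + p * y j) - x i * P
    - p * (y i * P + x i * S) = x i * E + p ^+ 2 * (y i * S) + p * (y i * E).
  by rewrite /E; ring.
have p2 : 0 <= p ^+ 2 by rewrite exprn_ge0 //; lra.
apply: (le_trans (ler_normD _ _)).
rewrite !mulrDl; apply: lerD.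
  apply: (le_trans (ler_normD _ _)); apply: lerD.
    by rewrite normrM -mulrA ler_wpM2l.
  by rewrite normrM (ger0_norm p2) normrM mulrC.
have {}p01 : `|p| <= 1 by rewrite ger0_norm; lra.
rewrite !normrM -[leRHS]mul1r; apply: ler_pM => //.
  by rewrite mulr_ge0.
by rewrite -mulrA; apply: ler_wpM2l.
Qed.

(* Give every player one of [q] colors uniformly at random, let [U c] be the
   product where the players of color [c] use [b] and the others use [a], and
   expand the expectation of [(\sum_c (U c - \prod_i a i)) ^+ 2]. *)
Lemma coloring_sum_squares (F : realFieldType) (I : finType) (m : nat)
    (a b : I -> F) (q := m.+1%:R : F) :
  0 <= q * \prod_i ((1 - q^-1) * a i ^+ 2 + q^-1 * b i ^+ 2)
     + q * (q - 1) * \prod_i (a i ^+ 2 + 2 / q * (a i * b i - a i ^+ 2))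
     - 2 * q ^+ 2 * \prod_i (a i ^+ 2 + q^-1 * (a i * b i - a i ^+ 2))
     + q ^+ 2 * \prod_i a i ^+ 2.
Proof.
have q0 : q != 0 by rewrite pnatr_eq0.
pose U (c : 'I_m.+1) (chi : {ffun I -> 'I_m.+1}) :=
  \prod_i (if chi i == c then b i else a i).
pose U0 := \prod_i a i.
pose E (f : {ffun I -> 'I_m.+1} -> F) := \sum_chi q^-1 ^+ #|I| * f chi.
have EP (f : I -> 'I_m.+1 -> F) :
    E (fun chi => \prod_i f i (chi i)) = \prod_i (q^-1 * \sum_c f i c).
  rewrite /E big_split /= prodr_const bigA_distr_bigA mulr_sumr.
  by [].
have sum1 (c : 'I_m.+1) (u v : F) :
    \sum_d (if d == c then u else v) = u + (q - 1) * v.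
  rewrite (bigD1 c) //= eqxx; congr (_ + _).
  rewrite (eq_bigr (fun=> v)) => [|d /negPf->//].
  rewrite sumr_const cardC1 card_ord /= /q -natr1 addrK.
  by rewrite mulr_natl.
have E0 : 0 <= E (fun chi => (\sum_c (U c chi - U0)) ^+ 2).
  apply: sumr_ge0 => chi _; rewrite mulr_ge0 ?sqr_ge0 //.
  by rewrite exprn_ge0 // invr_ge0 ler0n.
apply: le_trans E0 _; rewrite le_eqVlt; apply/orP; left; apply/eqP.
(* For equal colors a player contributes [b i ^+ 2] with probability [q^-1]; for distinct ones it
   has one of the two colors with probability [2 / q] and then contributes [a i * b i]. *)
have EUU c c' : E (fun chi => U c chi * U c' chi) = if c == c' then
    \prod_i ((1 - q^-1) * a i ^+ 2 + q^-1 * b i ^+ 2) else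
    \prod_i (a i ^+ 2 + 2 / q * (a i * b i - a i ^+ 2)).
  transitivity (E (fun chi => \prod_i ((if chi i == c then b i else a i) *
    (if chi i == c' then b i else a i)))).
    by apply: eq_bigr => chi _; rewrite big_split.
  rewrite (EP (fun i d => (if d == c then b i else a i) *
    (if d == c' then b i else a i))).
  case: eqP => [<-|/eqP cc']; apply: eq_bigr => i _.
    transitivity (q^-1 * \sum_d (if d == c then b i ^+ 2 else a i ^+ 2)).
      by congr (_ * _); apply: eq_bigr => d _; case: ifP => _; rewrite expr2.
    by rewrite sum1; move: (q) q0 => q' q0; field.
  rewrite (bigD1 c) //= eqxx (negPf cc') (bigD1 c') 1?eq_sym //= eqxx.
  rewrite (negPf cc') (eq_bigr (fun=> a i ^+ 2)).
    have -> : \sum_(d < m.+1 | (d != c) && (d != c')) a i ^+ 2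
        = (q - 2) * a i ^+ 2.
      have := sum1 c (a i ^+ 2) (a i ^+ 2).
      rewrite (bigD1 c) //= eqxx (bigD1 c') 1?eq_sym //= if_same => h.
      apply: (@addrI _ (a i ^+ 2 + a i ^+ 2)); rewrite -addrA.
      under eq_bigr => d _ do rewrite -[a i ^+ 2](if_same (d == c)).
      by rewrite h; ring.
    by move: (q) q0 => q' q0; field.
  by move=> d /andP[/negPf-> /negPf->]; rewrite expr2.
have EUU0 c : E (fun chi => U c chi * U0) =
    \prod_i (a i ^+ 2 + q^-1 * (a i * b i - a i ^+ 2)).
  transitivity (E (fun chi => \prod_i ((if chi i == c then b i else a i) * a i))).
    by apply: eq_bigr => chi _; rewrite big_split.
  rewrite (EP (fun i d => (if d == c then b i else a i) * a i)).
  apply: eq_bigr => i _; rewrite -mulr_suml sum1; by move: (q) q0 => q' q0; field.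
have E00 : E (fun chi => U0 ^+ 2) = \prod_i a i ^+ 2.
  rewrite /E sumr_const card_ffun card_ord -mulr_natl natrX mulrA -exprMn.
  by rewrite mulfV // expr1n mul1r prodrXl.
transitivity (\sum_c \sum_c' (E (fun chi => U c chi * U c' chi)
   - E (fun chi => U c chi * U0) - E (fun chi => U c' chi * U0)
   + E (fun chi => U0 ^+ 2))).
  under [RHS]eq_bigr => c _ do under eq_bigr => c' _ do
    rewrite /E -!sumrB -big_split /=.
  under [RHS]eq_bigr do rewrite exchange_big /=.
  rewrite exchange_big /=; apply: eq_bigr => chi _.
  rewrite expr2 big_distrlr mulr_sumr; apply: eq_bigr => c _.
  rewrite mulr_sumr; apply: eq_bigr => c' _; rewrite /=; ring.
set PA := \prod_i ((1 - q^-1) * a i ^+ 2 + q^-1 * b i ^+ 2).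
set PB := \prod_i (a i ^+ 2 + 2 / q * (a i * b i - a i ^+ 2)).
set PC := \prod_i (a i ^+ 2 + q^-1 * (a i * b i - a i ^+ 2)).
set PD := \prod_i a i ^+ 2.
transitivity (\sum_(c < m.+1) \sum_(c' < m.+1)
    ((if c' == c then PA else PB) - PC - PC + PD)).
  apply: eq_bigr => c _; apply: eq_bigr => c' _.
  by rewrite EUU !EUU0 E00 eq_sym.
have sumc (x : F) : \sum_(c < m.+1) x = q * x.
  by rewrite sumr_const card_ord -mulr_natl.
under eq_bigr => c _ do rewrite big_split /= !sumrB sum1 !sumc.
by rewrite sumc; ring.
Qed.

Lemma sum_prod_affine_taylor (F : realFieldType) (I : finType) (T : Type)
    (s : seq T) (x y : T -> I -> F) :
  exists2 K, 0 <= K & forall p, 0 <= p <= 1 ->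
    `|\sum_(l <- s) \prod_i (x l i + p * y l i) - \sum_(l <- s) \prod_i x l i
      - p * \sum_(l <- s) \sum_i y l i * \prod_(j | j != i) x l j|
    <= K * p ^+ 2.
Proof.
elim: s => [|l s [K K0 HK]].
  by exists 0 => // p _; rewrite !big_nil mulr0 !subr0 normr0 mul0r.
have [K' K'0 HK'] := @prod_affine_taylor F I (index_enum I) (x l) (y l)
  (index_enum_uniq I).
exists (K' + K) => [|p p01]; first exact: addr_ge0.
have := lerD (HK' p p01) (HK p p01); rewrite -mulrDl; apply: le_trans.
apply: le_trans (ler_normD _ _); rewrite le_eqVlt; apply/orP; left; apply/eqP.
by rewrite !big_cons; congr (`|_|); ring.
Qed.

(* Let [G p] be the expected squared Hellinger distance when every player is
   switched from [a] to [b] with probability [p].  [coloring_sum_squares] with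
   [q] colors gives [(q - 1) G (2 / q) <= 2 q G (1 / q)]; along the powers of 2
   the accumulated factor stays below 4 because [\prod_t (1 - 2^-t) >= 1/4], and
   [G p / p] tends to the sum over single players as [p -> 0]. *)
Lemma hellinger_star (F : archiRealFieldType) (I : finType) (T : Type)
    (s : seq T) (a b : T -> I -> F) :
  (forall p, \sum_(l <- s) \prod_i ((1 - p) * a l i ^+ 2 + p * b l i ^+ 2) = 1) ->
  1 - \sum_(l <- s) \prod_i (a l i * b l i) <=
  4 * \sum_i (1 - \sum_(l <- s) a l i * b l i * \prod_(j | j != i) a l j ^+ 2).
Proof.
move=> H.
pose G p : F := 1 - \sum_(l <- s) \prod_i (a l i ^+ 2 + p * (a l i * b l i - a l i ^+ 2)).
have Ha : \sum_(l <- s) \prod_i a l i ^+ 2 = 1.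
  by apply: etrans (H 0); apply: eq_bigr => l _; apply: eq_bigr => i _; ring.
have Hb : \sum_(l <- s) \prod_i b l i ^+ 2 = 1.
  by apply: etrans (H 1); apply: eq_bigr => l _; apply: eq_bigr => i _; ring.
have -> : 1 - \sum_(l <- s) \prod_i (a l i * b l i) = G 1.
  congr (1 - _); apply: eq_bigr => l _; apply: eq_bigr => i _; ring.
set eta := \sum_i _.
(* Twice [G 1] is the sum over [s] of the squares of [\prod_i a l i - \prod_i b l i]. *)
have G1 : 0 <= G 1.
  have -> : G 1 = 1 - \sum_(l <- s) \prod_i a l i * \prod_i b l i.
    congr (1 - _); apply: eq_bigr => l _; rewrite -big_split.
    by apply: eq_bigr => i _ /=; ring.
  have : 0 <= \sum_(l <- s) (\prod_i a l i - \prod_i b l i) ^+ 2.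
    by apply: sumr_ge0 => l _; apply: sqr_ge0.
  under eq_bigr => l _ do rewrite sqrrB -!prodrXl.
  rewrite big_split sumrB /= Ha Hb sumrMnl.
  by lra.
have step (m : nat) (q : F) : q = m.+1%:R ->
    (q - 1) * G (2 / q) <= 2 * q * G q^-1.
  move=> qE; have q0 : 0 < q by rewrite qE ltr0n.
  have : 0 <= \sum_(l <- s) (q * \prod_i ((1 - q^-1) * a l i ^+ 2 + q^-1 * b l i ^+ 2)
     + q * (q - 1) * \prod_i (a l i ^+ 2 + 2 / q * (a l i * b l i - a l i ^+ 2))
     - 2 * q ^+ 2 * \prod_i (a l i ^+ 2 + q^-1 * (a l i * b l i - a l i ^+ 2))
     + q ^+ 2 * \prod_i a l i ^+ 2).
    by apply: sumr_ge0 => l _; rewrite qE; apply: coloring_sum_squares.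
  rewrite big_split sumrB !big_split /= -!mulr_sumr Ha H.
  have -> (u v : F) : q * 1 + q * (q - 1) * u - 2 * q ^+ 2 * v + q ^+ 2 * 1
     = q * (2 * q * (1 - v) - (q - 1) * (1 - u)) by ring.
  by rewrite pmulr_rge0 // subr_ge0.
(* The factor survives the induction: for [z = 2^-1 ^+ t.+1 <= 2^-1], the step with [2 / z] colors
   multiplies [4^-1 + z / 2] by [1 - z / 2], which leaves at least [4^-1 + z / 4]. *)
have Gpow t : (4^-1 + 2^-1 ^+ t.+2) * G 1 <= 2 ^+ t.+1 * G (2^-1 ^+ t.+1).
  elim: t => [|t IH].
    have := step 1 2 erefl; rewrite divff ?pnatr_eq0 //.
    by rewrite !expr1 !expr2; move: G1; lra.
  set z := 2^-1 ^+ t.+1 in IH *.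
  have z0 : 0 < z by rewrite exprn_gt0 ?invr_gt0 ?ltr0n.
  have z1 : z <= 2^-1.
    by rewrite /z exprS ger_pMr ?invr_gt0 ?ltr0n // exprn_ile1 ?invr_ge0 ?ler0n //; lra.
  have e2 : 2 ^+ t.+1 = z^-1 :> F by rewrite /z exprVn invrK.
  have [m qE] : exists m, 2 * z^-1 = m.+1%:R.
    exists (2 ^ t.+2).-1; rewrite prednK ?expn_gt0 //.
    by rewrite -e2 -exprS natrX.
  have := step m _ qE; rewrite invfM invrK mulrA divff ?pnatr_eq0 // mul1r.
  rewrite ![_ ^+ t.+2]exprS ![_ ^+ t.+3]exprS -/z e2.
  have zz : z * z^-1 = 1 by rewrite divff // gt_eqF.
  move: IH; rewrite [_ ^+ t.+2]exprS -/z e2 => IH.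
  set g := G (2^-1 * z); set h := G z in IH * => st.
  have {}st : (1 - z / 2) * (z^-1 * h) <= 2 * z^-1 * g.
    have zi : 0 < z^-1 by rewrite invr_gt0.
    have := st; rewrite -(ler_pM2l z0).
    have -> : z * ((2 * z^-1 - 1) * h) = (2 * (z * z^-1) - z) * h by ring.
    have -> : z * (2 * (2 * z^-1) * g) = 4 * (z * z^-1) * g by ring.
    rewrite zz; move=> st'.
    rewrite mulrA -[leLHS]mulrA.
    have -> : 2 * z^-1 * g = z^-1 * (2 * g) by ring.
    have -> : (1 - z / 2) * (z^-1 * h) = z^-1 * ((1 - z / 2) * h) by ring.
    by rewrite ler_pM2l //; lra.
  apply: le_trans st.
  apply: (@le_trans _ _ ((1 - z / 2) * ((4^-1 + 2^-1 * z) * G 1))); last first.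
    by apply: ler_wpM2l => //; lra.
  rewrite [leRHS]mulrA; apply: ler_wpM2r => //.
  by nra.
have [K K0 HK] := @sum_prod_affine_taylor F I T s (fun l i => a l i ^+ 2)
  (fun l i => a l i * b l i - a l i ^+ 2).
have Geta p : 0 <= p <= 1 -> G p <= p * eta + K * p ^+ 2.
  move=> /HK; rewrite Ha.
  have -> : \sum_(l <- s) \sum_i (a l i * b l i - a l i ^+ 2) *
       \prod_(j | j != i) a l j ^+ 2 = - eta.
    rewrite exchange_big -sumrN; apply: eq_bigr => i _ /=.
    rewrite opprB; transitivity (\sum_(l <- s) a l i * b l i *
      \prod_(j | j != i) a l j ^+ 2 - \sum_(l <- s) \prod_i a l i ^+ 2).
      rewrite -sumrB; apply: eq_bigr => l _.
      by rewrite mulrBl [X in _ = _ - X](bigD1 i).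
    by rewrite Ha.
  by rewrite /G ler_norml; set u := \sum_(l <- s) _; lra.
rewrite leNgt; apply/negP => lt.
have d0 : 0 < G 1 - 4 * eta by lra.
(* At [p = 2^-1 ^+ t.+1] the remainder divided by [p] is then below a quarter of the assumed gap. *)
have [t Ht] : exists t, 4 * K / (G 1 - 4 * eta) < 2 ^+ t.+1.
  exists (Num.bound (4 * K / (G 1 - 4 * eta))).
  apply: lt_trans (archi_boundP _) _; first by rewrite divr_ge0 ?mulr_ge0 // ltW.
  by rewrite -natrX ltr_nat ltnW // ltn_expl.
move: Ht; rewrite ltr_pdivrMr //.
set y : F := 2 ^+ t.+1 => Ht.
have y0 : 0 < y by rewrite exprn_gt0.
have zE : 2^-1 ^+ t.+1 = y^-1 by rewrite exprVn.
have yi : 0 < y^-1 by rewrite invr_gt0.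
have yy : y * y^-1 = 1 by rewrite divff // gt_eqF.
have y1 : y^-1 <= 1 by rewrite invf_le1 // exprn_ege1 //; lra.
have := Gpow t; rewrite [_ ^+ t.+2]exprS zE -/y => A1.
have A2 : y * G y^-1 <= eta + K * y^-1.
  have := Geta y^-1; rewrite ltW // y1 => /(_ isT) A3.
  have := ler_wpM2l (ltW y0) A3.
  have -> : y * (y^-1 * eta + K * y^-1 ^+ 2)
    = (y * y^-1) * eta + K * y^-1 * (y * y^-1) by ring.
  by rewrite yy mul1r mulr1.
have A4 : 4 * K * y^-1 < G 1 - 4 * eta.
  by rewrite ltr_pdivrMr // [ltRHS]mulrC.
have : 0 <= 2^-1 * y^-1 * G 1 
  by rewrite mulr_ge0 // mulr_ge0 ?(ltW yi) // invr_ge0 ler0n.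
by lra.
Qed.

(** * Product weights on finite functions and resampling of one coordinate *)

Definition upd (I T : finType) (f : {ffun I -> T}) (j : I) (a : T) :
  {ffun I -> T} := [ffun j' => if j' == j then a else f j'].

Definition prodw (F : comNzRingType) (I T : finType) (m : I -> T -> F)
  (f : {ffun I -> T}) : F := \prod_j m j (f j).

Arguments upd {I T} f j a.
Arguments prodw {F I T} m f.

Lemma upd_upd (I T : finType) (f : {ffun I -> T}) j a b :
  upd (upd f j a) j b = upd f j b.
Proof. by apply/ffunP => i; rewrite !ffunE; case: eqP. Qed.

Lemma upd_id (I T : finType) (f : {ffun I -> T}) j : upd f j (f j) = f.
Proof. by apply/ffunP => i; rewrite !ffunE; case: eqP => [->|]. Qed.

Lemma upd_eq (I T : finType) (f : {ffun I -> T}) j a : upd f j a j = a.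
Proof. by rewrite ffunE eqxx. Qed.

Lemma prodw_ge0 (F : realFieldType) (I T : finType) (m : I -> T -> F) f :
  (forall j a, 0 <= m j a) -> 0 <= prodw m f.
Proof. by move=> m0; apply: prodr_ge0. Qed.

Lemma sum_prodw (F : comNzRingType) (I T : finType) (m : I -> T -> F) :
  \sum_f prodw m f = \prod_j \sum_a m j a.
Proof. by rewrite bigA_distr_bigA. Qed.

(** Exchanging the value at [j] with the fresh value [a] is an involution; since the weights agree
    off [j], it also exchanges [m] and [m']. *)
Lemma prodw_swap (F : comNzRingType) (I T : finType) (m m' : I -> T -> F) j
    (H : {ffun I -> T} -> T -> F) :
  (forall j', j' != j -> m j' =1 m' j') ->
  \sum_f \sum_a prodw m f * m' j a * H f a =
  \sum_f \sum_a prodw m' f * m j a * H (upd f j a) (f j).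
Proof.
move=> mm'; rewrite !pair_big /=.
pose h (p : {ffun I -> T} * T) := (upd p.1 j p.2, p.1 j).
rewrite (reindex_inj (h := h)).
  apply: eq_bigr => -[f a] _ /=; congr (_ * _).
  rewrite /prodw (bigD1 j) //= upd_eq [in RHS](bigD1 j) //=.
  rewrite mulrC mulrA mulrAC; congr (_ * _ * _).
  by apply: eq_bigr => i ij; rewrite ffunE (negPf ij) mm'.
apply: inv_inj => -[f a].
by rewrite /h /= upd_upd upd_id upd_eq.
Qed.

Lemma prodw_resample (F : comNzRingType) (I T : finType) (m : I -> T -> F) j
    (H : {ffun I -> T} -> F) : \sum_a m j a = 1 ->
  \sum_f prodw m f * H f = \sum_f prodw m f * \sum_a m j a * H (upd f j a).
Proof.
move=> m1; have := @prodw_swap F I T m m j (fun f _ => H f) (fun _ _ _ => erefl).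
under eq_bigr => f _ do rewrite -mulr_suml -mulr_sumr m1 mulr1.
move=> ->; apply: eq_bigr => f _; rewrite mulr_sumr.
by apply: eq_bigr => a _; rewrite mulrA.
Qed.

Lemma prodw_indep (F : comNzRingType) (I T : finType) (m m' : I -> T -> F) j
    (H : {ffun I -> T} -> F) :
  (forall j', j' != j -> m j' =1 m' j') ->
  \sum_a m j a = 1 -> \sum_a m' j a = 1 -> (forall f a, H (upd f j a) = H f) ->
  \sum_f prodw m f * H f = \sum_f prodw m' f * H f.
Proof.
move=> mm' m1 m1' HH; have := prodw_swap (fun f _ => H f) mm'.
under eq_bigr => f _ do rewrite -mulr_suml -mulr_sumr m1' mulr1.
move=> ->; apply: eq_bigr => f _.
under eq_bigr => a _ do rewrite HH.
by rewrite -mulr_suml -mulr_sumr m1 mulr1.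
Qed.

(** * Leaves of a protocol as rectangles, and Kraft's identity *)

Definition leaf (k n : nat) : Type :=
  ({ffun 'I_k -> {set BV n}} * {ffun 'I_k -> nat} * bool)%type.

(* [A] is the rectangle of inputs reaching the root of [t] and [c i] counts the
   bits already written there by player [i]. *)
Fixpoint leaves_from (k n : nat) (t : protocol k n)
    (A : {ffun 'I_k -> {set BV n}}) (c : {ffun 'I_k -> nat}) : seq (leaf k n) :=
  match t with
  | Leaf b => [:: (A, c, b)]
  | Node i f t0 t1 =>
      let c' := [ffun i' => (c i' + (i == i'))%N] in
      leaves_from t0 [ffun i' => [set x in A i' | (i' == i) ==> ~~ f x]] c' ++
      leaves_from t1 [ffun i' => [set x in A i' | (i' == i) ==> f x]] c'
  end.

Definition leaves (k n : nat) (t : protocol k n) : seq (leaf k n) :=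
  leaves_from t [ffun=> setT] [ffun=> 0%N].

(** [P] marks the players whose test is waived: nobody in [sum_leaves], player [i] in [kraft]. *)
Lemma forall_refine (k n : nat) (A : {ffun 'I_k -> {set BV n}}) (f : pred (BV n))
    i (P : pred 'I_k) (X : Input k n) :
  [forall j, P j || (X j \in [ffun i' => [set x in A i' | (i' == i) ==> f x]] j)]
  = [forall j, P j || (X j \in A j)] && (P i || f (X i)).
Proof.
apply/forallP/andP => [H|[/forallP H fi] j].
  split; first by apply/forallP => j; move: (H j); rewrite ffunE inE;
    case: (P j) => //= /andP[].
  by move: (H i); rewrite ffunE inE eqxx; case: (P i) => //= /andP[].
move: (H j); rewrite ffunE inE; case PE: (P j) => //= -> /=.
by apply/implyP => /eqP ji; move: fi; rewrite -ji PE.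
Qed.

Lemma sum_leaves (F : comNzRingType) (k n : nat) (t : protocol k n) A c
    (phi : bool -> F) (X : Input k n) :
  \sum_(l <- leaves_from t A c) phi l.2 * [forall i, X i \in l.1.1 i]%:R
  = phi (run t X) * [forall i, X i \in A i]%:R.
Proof.
elim: t A c => [b|i f t0 IH0 t1 IH1] A c; first by rewrite big_seq1.
rewrite big_cat /= IH0 IH1.
have := forall_refine A (fun x => ~~ f x) i pred0 X => /= ->.
have := forall_refine A f i pred0 X => /= ->.
by case: (f (X i)); rewrite ?andbT ?andbF !mulr0 ?addr0 ?add0r.
Qed.

(** Membership in a leaf's rectangle forces [X] down the path to that leaf, so the counter there
    records the bits written on [X]. *)
Lemma leaves_bits (k n : nat) (t : protocol k n) A c l (X : Input k n) i :
  l \in leaves_from t A c -> (forall i', X i' \in l.1.1 i') ->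
  (forall i', X i' \in A i') /\ l.1.2 i = (c i + bits_written i t X)%N.
Proof.
elim: t A c => [b|i0 f t0 IH0 t1 IH1] A c /=.
  by rewrite inE => /eqP-> /=; rewrite addn0.
rewrite mem_cat => /orP[/IH0 H /H{H}[H ->]|/IH1 H /H{H}[H ->]].
  have [HA Hf] : (forall i', X i' \in A i') /\ ~~ f (X i0).
    split=> [i'|]; first by move: (H i'); rewrite ffunE inE => /andP[].
    by move: (H i0); rewrite ffunE inE eqxx => /andP[].
  by rewrite ffunE (negPf Hf) addnA.
have [HA Hf] : (forall i', X i' \in A i') /\ f (X i0).
  split=> [i'|]; first by move: (H i'); rewrite ffunE inE => /andP[].
  by move: (H i0); rewrite ffunE inE eqxx => /andP[].
by rewrite ffunE Hf addnA.
Qed.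

(* The bits of player [i] are left free: only the other players' inputs are
   tested against the rectangle. *)
Lemma kraft (F : realFieldType) (k n : nat) (t : protocol k n) A c i (X : Input k n) :
  \sum_(l <- leaves_from t A c)
    2^-1 ^+ l.1.2 i * [forall j, (j == i) || (X j \in l.1.1 j)]%:R
  = 2^-1 ^+ c i * [forall j, (j == i) || (X j \in A j)]%:R :> F.
Proof.
elim: t A c => [b|i0 f t0 IH0 t1 IH1] A c; first by rewrite big_seq1.
rewrite big_cat /= IH0 IH1 !ffunE.
have -> := forall_refine A (fun x => ~~ f x) i0 (pred1 i) X.
have -> := forall_refine A f i0 (pred1 i) X.
rewrite exprD /=; case: eqP => _ /=; last first.
  by case: (f (X i0)); rewrite ?andbT ?andbF ?mulr0 ?addr0 ?add0r expr0 mulr1.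
by rewrite !andbT expr1; set u := _%:R; field.
Qed.

Lemma prod_indicator (F : comNzRingType) (I : finType) (b : pred I) :
  \prod_i (b i)%:R = [forall i, b i]%:R :> F.
Proof.
case: forallP => [H|/forallP]; first by rewrite big1 // => i _; rewrite H.
by rewrite negb_forall => /existsP[i /negPf bi]; rewrite (bigD1 i) //= bi mul0r.
Qed.

(* A player holding [z] with weight [w i z] has input [g z]. *)
Lemma sum_leaves_prod (F : comNzRingType) (k n : nat) (t : protocol k n)
    (T : finType) (g : T -> BV n) (w : 'I_k -> T -> F) (phi : bool -> F) :
  \sum_(l <- leaves t) phi l.2 * \prod_i \sum_z w i z * (g z \in l.1.1 i)%:R
  = \sum_Z prodw w Z * phi (run t [ffun i => g (Z i)]).
Proof.
under eq_bigr => l _ do rewrite bigA_distr_bigA mulr_sumr.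
rewrite exchange_big /=; apply: eq_bigr => Z _.
under eq_bigr => l _ do rewrite big_split /= prod_indicator mulrCA.
rewrite -mulr_sumr; congr (_ * _).
have := @sum_leaves F k n t [ffun=> setT] [ffun=> 0%N] phi [ffun i => g (Z i)].
have -> : [forall i, [ffun i => g (Z i)] i \in [ffun=> [set: BV n]] i] = true.
  by apply/forallP => i; rewrite [[ffun=> [set: BV n]] i]ffunE inE.
rewrite mulr1 => <-; apply: eq_bigr => l _; congr (_ * _%:R).
by congr (nat_of_bool _); apply: eq_forallb => i; rewrite ffunE.
Qed.

(** This is [kraft] summed against a product weight; player [i], whose rectangle is not tested,
    contributes its total weight 1. *)
Lemma kraft_prod (F : realFieldType) (k n : nat) (t : protocol k n) i
    (w : 'I_k -> BV n -> F) : (forall j, \sum_x w j x = 1) ->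
  \sum_(l <- leaves t) 2^-1 ^+ l.1.2 i *
    \prod_(j | j != i) \sum_x w j x * (x \in l.1.1 j)%:R = 1.
Proof.
move=> w1.
transitivity (\sum_(l <- leaves t) \sum_(Z : Input k n) prodw w Z *
   (2^-1 ^+ l.1.2 i * [forall j, (j == i) || (Z j \in l.1.1 j)]%:R)).
  apply: eq_bigr => l _.
  transitivity (2^-1 ^+ l.1.2 i * \prod_j \sum_x w j x * ((j == i) || (x \in l.1.1 j))%:R).
    congr (_ * _); rewrite [RHS](bigD1 i) //= -[LHS]mul1r; congr (_ * _).
      by apply: esym; apply: etrans (w1 i); apply: eq_bigr => x _; rewrite eqxx mulr1.
    by apply: eq_bigr => j /negPf->.
  rewrite bigA_distr_bigA mulr_sumr; apply: eq_bigr => Z _.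
  by rewrite big_split /= prod_indicator mulrCA.
rewrite exchange_big /=.
transitivity (\sum_(Z : Input k n) prodw w Z).
  apply: eq_bigr => Z _; rewrite -mulr_sumr kraft !ffunE expr0 mul1r.
  have -> : [forall j, (j == i) || (Z j \in [ffun=> [set: BV n]] j)] = true.
    by apply/forallP => j; rewrite ffunE inE orbT.
  by rewrite mulr1.
by rewrite sum_prodw big1.
Qed.

(** * Exponential moments and the level-one inequality *)

Lemma expD (x y : R) : exp (x + y) = exp x * exp y.
Proof. by rewrite expRD. Qed.

Lemma exp_ge1Dx (x : R) : 1 + x <= exp x.
Proof. exact/RleP/exp_ineq1_le. Qed.

Lemma exp_gt0 (x : R) : 0 < exp x.
Proof. exact/RltP/Exp_prop.exp_pos. Qed.

Lemma exp_sum (I : finType) (P : pred I) (f : I -> R) :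
  exp (\sum_(i | P i) f i) = \prod_(i | P i) exp (f i).
Proof. exact: (big_morph exp expD expR0). Qed.

(** Follows from [1 - t <= exp (- t)], because [(1 - t) * (1 + t + 2 * t ^+ 2) = 1 + t ^+ 2 * (1 - 2
    * t)]. *)
Lemma exp_le_quadratic (t : R) : t <= 2^-1 -> exp t <= 1 + t + 2 * t ^+ 2.
Proof.
move=> t2; have t1 : 0 < 1 - t by lra.
rewrite -(ler_pM2r t1).
apply: (@le_trans _ _ 1); last first.
  have : 0 <= t ^+ 2 * (1 - 2 * t) by rewrite mulr_ge0 ?sqr_ge0 //; lra.
  by rewrite expr2; lra.
have e1 : exp t * exp (- t) = 1 by rewrite -expD subrr expR0.
rewrite -[leRHS]e1.
by apply: ler_wpM2l (exp_ge1Dx _); apply/ltW/exp_gt0.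
Qed.

Lemma cosh_le_exp (t : R) : `|t| <= 2^-1 ->
  2^-1 * exp t + 2^-1 * exp (- t) <= exp (2 * t ^+ 2).
Proof.
rewrite ler_norml => /andP[t1 t2].
have h1 := exp_le_quadratic t2.
have := @exp_le_quadratic (- t); rewrite sqrrN => /(_ ltac:(lra)) h2.
by have := exp_ge1Dx (2 * t ^+ 2); lra.
Qed.

(** The tangent of [exp] at [c] lies below the curve; this stands in for Jensen's inequality in
    [level_one] and [sum_bias_le]. *)
Lemma exp_mul_ge (c y : R) : exp c * (1 + y - c) <= exp y.
Proof.
have -> : y = c + (y - c) by ring.
rewrite expD; apply: ler_wpM2l; first exact/ltW/exp_gt0.
rewrite -addrA.
have -> : c + (y - c) - c = y - c by ring.
exact: exp_ge1Dx.
Qed.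

Lemma exp_ge_pow2 (c : nat) : 2 ^+ c <= exp c%:R.
Proof.
elim: c => [|c IH]; first by rewrite expR0.
rewrite exprS -(nat1r c) expD ler_pM ?exprn_ge0 //.
by have := exp_ge1Dx 1; lra.
Qed.

Definition spin (b : bool) : R := if b then -1 else 1.

(* Jensen's inequality for the exponential moment of [\sum_j b j * spin (x j)]
   on [A] replaces the subadditivity of entropy. *)
Lemma level_one (I : finType) (S : pred I) (m : I -> bool -> R)
    (A : {set {ffun I -> bool}})
    (p := \sum_x prodw m x * (x \in A)%:R)
    (b := fun j => (\sum_x prodw m x * (x \in A)%:R * spin (x j)) / p) :
  (forall j a, 0 <= m j a) -> (forall j, \sum_a m j a = 1) ->
  (forall j a, S j -> m j a = 2^-1) -> 0 < p ->
  p * exp (8^-1 * \sum_(j | S j) b j ^+ 2) <= 1.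
Proof.
move=> m0 m1 mS p0.
pose W x := prodw m x * (x \in A)%:R.
have W0 x : 0 <= W x by rewrite mulr_ge0 ?ler0n ?prodw_ge0.
have b1 j : `|b j| <= 1.
  rewrite normrM normfV (gtr0_norm p0) ler_pdivrMr // mul1r.
  apply: (le_trans (ler_norm_sum _ _ _)); apply: ler_sum => x _.
  rewrite normrM (ger0_norm (W0 x)) /spin.
  by case: (x j); rewrite ?normrN normr1 mulr1.
(* A slope [s] yields the gain [s - 2 * s ^+ 2], largest at [s = 4^-1] with value [8^-1]; it also
   keeps each exponent within the range of [cosh_le_exp]. *)
pose Z (x : {ffun I -> bool}) := \sum_(j | S j) 4^-1 * b j * spin (x j).
set B := \sum_(j | S j) b j ^+ 2.
have upper : \sum_x prodw m x * exp (Z x) <= exp (8^-1 * B).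
  under eq_bigr => x _ do rewrite exp_sum [X in _ * X]big_mkcond -big_split /=.
  rewrite -(bigA_distr_bigA (fun j a => m j a *
    (if S j then exp (4^-1 * b j * spin a) else 1))) /=.
  rewrite mulr_sumr exp_sum [leRHS]big_mkcond /=.
  apply: ler_prod => j _; apply/andP; split.
    apply: sumr_ge0 => a _; rewrite mulr_ge0 //.
    by case: ifP => // _; rewrite ltW // exp_gt0.
  case: ifP => Sj; last by under eq_bigr do rewrite mulr1; rewrite m1.
  rewrite big_bool /= !mS // mulr1 mulrN1 addrC.
  have -> : 8^-1 * b j ^+ 2 = 2 * (4^-1 * b j) ^+ 2 by field.
  apply: cosh_le_exp; have := b1 j; rewrite !ler_norml; lra.
(* The tangent is taken at [4^-1 * B], the mean of [Z] conditioned on [A]. *)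
have lower : p * exp (4^-1 * B) <= \sum_x prodw m x * exp (Z x).
  apply: (@le_trans _ _ (\sum_x W x * (exp (4^-1 * B) * (1 + Z x - 4^-1 * B)))).
    have -> : \sum_x W x * (exp (4^-1 * B) * (1 + Z x - 4^-1 * B))
      = exp (4^-1 * B) * (p * (1 - 4^-1 * B) + \sum_x W x * Z x).
      rewrite mulrDr mulr_suml !mulr_sumr -big_split; apply: eq_bigr => x _.
      by rewrite /= /W; ring.
    have -> : \sum_x W x * Z x = p * (4^-1 * B).
      under eq_bigr => x _ do rewrite mulr_sumr.
      rewrite exchange_big !mulr_sumr; apply: eq_bigr => j _ /=.
      under eq_bigr => x _ do rewrite mulrCA.
      rewrite -mulr_sumr.
      have -> : \sum_x W x * spin (x j) = b j * p by rewrite divfK // gt_eqF.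
      by ring.
    rewrite le_eqVlt; apply/orP; left; apply/eqP; ring.
  apply: ler_sum => x _; rewrite /W -mulrA; apply: ler_wpM2l.
    by rewrite prodw_ge0.
  case: (x \in A); rewrite ?mul1r ?exp_mul_ge // mul0r.
  by rewrite ltW // exp_gt0.
have := le_trans lower upper.
have -> : 4^-1 * B = 8^-1 * B + 8^-1 * B by field.
by rewrite expD mulrA ger_pMl // exp_gt0.
Qed.

(** * Inputs given the holders of the free bits: masses and biases *)

Definition choice_weight (k : nat) (nu : 'I_k -> R) (a : option 'I_k) : R :=
  if a is Some i then nu i else 1 - \sum_i nu i.

Definition bit_weight (k : nat) (a : option 'I_k) (i : 'I_k) (b : bool) : R :=
  if a == Some i then 2^-1 else (~~ b)%:R.

Definition input_weight (k n : nat) (D : {ffun 'I_n -> option 'I_k}) (i : 'I_k) :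
  BV n -> R := prodw (fun j => bit_weight (D j) i).

Lemma bit_weight_ge0 k (a : option 'I_k) i b : 0 <= bit_weight a i b.
Proof. by rewrite /bit_weight; case: ifP => _; rewrite ?invr_ge0 ler0n. Qed.

Lemma sum_bit_weight k (a : option 'I_k) i : \sum_b bit_weight a i b = 1.
Proof. by rewrite big_bool /bit_weight; case: ifP => _ /=; lra. Qed.

Lemma input_weight_ge0 k n (D : {ffun 'I_n -> option 'I_k}) i x :
  0 <= input_weight D i x.
Proof. by apply: prodw_ge0 => *; apply: bit_weight_ge0. Qed.

Lemma sum_input_weight k n (D : {ffun 'I_n -> option 'I_k}) i :
  \sum_x input_weight D i x = 1.
Proof. by rewrite sum_prodw big1 // => j _; rewrite sum_bit_weight. Qed.

Definition mass (k n : nat) (D : {ffun 'I_n -> option 'I_k}) (i : 'I_k)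
  (A : {set BV n}) : R := \sum_x input_weight D i x * (x \in A)%:R.

(* Overwriting bit [j] by [v] amounts to conditioning on it, as the other bits
   are independent of it; unlike conditioning it also makes sense when
   [D j != Some i] and [v] has probability 0. *)
Definition cmass (k n : nat) (D : {ffun 'I_n -> option 'I_k}) (j : 'I_n)
    (v : bool) (i : 'I_k) (A : {set BV n}) : R :=
  \sum_x input_weight D i x * (upd x j v \in A)%:R.

(** The mean of [spin (x j)] conditioned on [A]; division by zero makes it 0 when [A] has mass 0. *)
Definition bias (k n : nat) (D : {ffun 'I_n -> option 'I_k}) (i : 'I_k)
    (A : {set BV n}) (j : 'I_n) : R :=
  (\sum_x input_weight D i x * (x \in A)%:R * spin (x j)) / mass D i A.

Lemma mass_ge0 k n (D : {ffun 'I_n -> option 'I_k}) i A : 0 <= mass D i A.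
Proof. by apply: sumr_ge0 => x _; rewrite mulr_ge0 ?input_weight_ge0. Qed.

Lemma cmass_ge0 k n (D : {ffun 'I_n -> option 'I_k}) j v i A :
  0 <= cmass D j v i A.
Proof. by apply: sumr_ge0 => x _; rewrite mulr_ge0 ?input_weight_ge0. Qed.

Lemma cmass_upd k n (D : {ffun 'I_n -> option 'I_k}) j a v i A :
  cmass (upd D j a) j v i A = cmass D j v i A.
Proof.
apply: (@prodw_indep _ _ _ _ _ j (fun x => (upd x j v \in A)%:R)).
- by move=> j' j'j b; rewrite ffunE (negPf j'j).
- exact: sum_bit_weight.
- exact: sum_bit_weight.
- by move=> x b; rewrite upd_upd.
Qed.

(** Resampling bit [j] splits the mass by its value; a player other than the holder always has bit 0
    there. *)
Lemma mass_cmass k n (D : {ffun 'I_n -> option 'I_k}) j i A :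
  mass D i A = if D j == Some i then 2^-1 * (cmass D j false i A + cmass D j true i A)
               else cmass D j false i A.
Proof.
rewrite /mass /input_weight (prodw_resample (j := j)) ?sum_bit_weight //.
under eq_bigr => x _ do rewrite big_bool /= /bit_weight.
case: eqP => _.
  by rewrite /cmass /input_weight -big_split mulr_sumr; apply: eq_bigr => x _ /=; ring.
by apply: eq_bigr => x _; rewrite mul0r add0r mul1r.
Qed.

Lemma bias_cmass k n (D : {ffun 'I_n -> option 'I_k}) j i A :
  D j = Some i ->
  bias D i A j = 2^-1 * (cmass D j false i A - cmass D j true i A) / mass D i A.
Proof.
move=> Dj; congr (_ / _); rewrite /input_weight.
under eq_bigr => x _ do rewrite -mulrA.
rewrite (prodw_resample (j := j) (fun x => (x \in A)%:R * spin (x j))) ?sum_bit_weight //.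
under eq_bigr => x _ do rewrite big_bool /= /bit_weight Dj eqxx !upd_eq /=.
by rewrite /cmass /input_weight -sumrB mulr_sumr; apply: eq_bigr => x _ /=; ring.
Qed.

Lemma sum_leaves_mass k n (D : {ffun 'I_n -> option 'I_k}) (P : protocol k n) :
  \sum_(l <- leaves P) \prod_i mass D i (l.1.1 i) = 1.
Proof.
have := @sum_leaves_prod R k n P _ id (input_weight D) (fun=> 1).
under eq_bigr do rewrite mul1r.
move=> ->; under eq_bigr do rewrite mulr1.
by rewrite sum_prodw big1 // => i _; rewrite sum_input_weight.
Qed.

(** By [level_one], [p l * exp (y l)] is at most the product of the other players' masses. Over the
    leaves of positive probability these products sum to at most [2 ^+ c <= exp c%:R], by Kraft and
    the bound on the bits. The tangent of [exp] at [c] then bounds the mean of [y] by [c]. *)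
Lemma sum_bias_le k n (D : {ffun 'I_n -> option 'I_k}) (P : protocol k n) cb i :
  bounded cb P ->
  \sum_(l <- leaves P) (\prod_i' mass D i' (l.1.1 i')) *
     \sum_(j | D j == Some i) bias D i (l.1.1 i) j ^+ 2 <= 8 * (cb i)%:R.
Proof.
move=> Pcb; set c := cb i.
pose p (l : leaf k n) := \prod_i' mass D i' (l.1.1 i').
pose y (l : leaf k n) := 8^-1 * \sum_(j | D j == Some i) bias D i (l.1.1 i) j ^+ 2.
have key l : l \in leaves P -> p l * (exp c%:R * (1 + y l - c%:R)) <=
   2 ^+ c * (2^-1 ^+ l.1.2 i * \prod_(i' | i' != i) mass D i' (l.1.1 i')).
  move=> lP; set Q := \prod_(i' | i' != i) _.
  have Q0 : 0 <= Q by apply: prodr_ge0 => *; apply: mass_ge0.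
  have pQ : p l = mass D i (l.1.1 i) * Q by rewrite /p (bigD1 i).
  have [p0|pn0] := eqVneq (p l) 0.
    by rewrite p0 mul0r !mulr_ge0 // exprn_ge0 ?invr_ge0.
  have m0 i' : 0 < mass D i' (l.1.1 i').
    rewrite lt_def mass_ge0 andbT; apply: contraNneq pn0 => m0.
    by rewrite /p (bigD1 i') //= m0 mul0r.
  (* [bounded] speaks of inputs, so an input reaching the leaf is exhibited to bound its counter. *)
  have reach i' : exists x, x \in l.1.1 i'.
    apply/set0Pn; apply/eqP => l0; have := m0 i'.
    rewrite /mass big1 ?ltxx // => x _; by rewrite l0 inE mulr0.
  have [X HX] : exists X : Input k n, forall i', X i' \in l.1.1 i'.
    exists [ffun i' => xchoose (reach i')] => i'; rewrite ffunE; exact: xchooseP.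
  have [_] := leaves_bits i lP HX; rewrite ffunE add0n => bits.
  apply: (@le_trans _ _ Q); last first.
    rewrite mulrA ler_peMl // bits -[c](subnK (Pcb X i)) exprD -mulrA -exprMn.
    by rewrite divff ?pnatr_eq0 // expr1n mulr1 exprn_ege1 // ler1n.
  apply: (@le_trans _ _ (p l * exp (y l))).
    by apply: ler_wpM2l; [apply: prodr_ge0 => *; apply: mass_ge0|apply: exp_mul_ge].
  rewrite pQ mulrAC ger_pMl; last first.
    by apply: prodr_gt0.
  apply: level_one => //.
  - by move=> *; apply: bit_weight_ge0.
  - by move=> *; apply: sum_bit_weight.
  - by move=> j a /eqP Dj; rewrite /bit_weight Dj eqxx.
  - exact: m0.
have : \sum_(l <- leaves P) p l * (exp c%:R * (1 + y l - c%:R)) <= exp c%:R.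
  apply: le_trans (exp_ge_pow2 c); rewrite -[leRHS]mulr1.
  rewrite -[X in _ <= _ * X](kraft_prod P i (sum_input_weight D)).
  rewrite mulr_sumr big_seq [leRHS]big_seq; apply: ler_sum => l; exact: key.
have -> : \sum_(l <- leaves P) p l * (exp c%:R * (1 + y l - c%:R))
  = exp c%:R * ((1 - c%:R) * \sum_(l <- leaves P) p l + \sum_(l <- leaves P) p l * y l).
  by rewrite mulrDr !mulr_sumr -big_split; apply: eq_bigr => l _ /=; ring.
rewrite sum_leaves_mass mulr1 ger_pMr ?exp_gt0 //.
have -> : \sum_(l <- leaves P) p l * y l = 8^-1 * \sum_(l <- leaves P) (p l *
     \sum_(j | D j == Some i) bias D i (l.1.1 i) j ^+ 2).
  by rewrite mulr_sumr; apply: eq_bigr => l _; rewrite mulrCA.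
by lra.
Qed.

(** * The distribution [D0] as a mixture over the choices of holders *)

Lemma big_option (F : nmodType) (T : finType) (f : option T -> F) :
  \sum_a f a = f None + \sum_i f (Some i).
Proof.
rewrite (bigD1 None) //=; congr (_ + _).
rewrite (reindex_omap Some id) /=; last by case.
by apply: eq_bigl => i; rewrite eqxx.
Qed.

Definition choices_weight (k n : nat) (nu : 'I_k -> R) :
  {ffun 'I_n -> option 'I_k} -> R := prodw (fun=> choice_weight nu).

Lemma choice_weight_ge0 k (nu : 'I_k -> R) a : subdistr nu -> 0 <= choice_weight nu a.
Proof. by case=> nu0 nu1; case: a => [i|] //=; rewrite subr_ge0. Qed.

Lemma sum_choice_weight k (nu : 'I_k -> R) : \sum_a choice_weight nu a = 1.
Proof. by rewrite big_option /= subrK. Qed.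

Lemma choices_weight_ge0 k n (nu : 'I_k -> R) (D : {ffun 'I_n -> option 'I_k}) :
  subdistr nu -> 0 <= choices_weight nu D.
Proof. by move=> nuP; apply: prodw_ge0 => _ a; apply: choice_weight_ge0. Qed.

Lemma sum_choices_weight k n (nu : 'I_k -> R) :
  \sum_(D : {ffun 'I_n -> option 'I_k}) choices_weight nu D = 1.
Proof. by rewrite sum_prodw big1 // => j _; rewrite sum_choice_weight. Qed.

(** Given the holder of the free bit, the bits of a column are independent: uniform for the holder,
    0 for the others. *)
Lemma col_probE k (nu : 'I_k -> R) (col : {ffun 'I_k -> bool}) :
  col_prob nu col = \sum_a choice_weight nu a * \prod_i bit_weight a i (col i).
Proof.
rewrite big_option /=; congr (_ * _ + _).
  rewrite /bit_weight /= prod_indicator; congr (nat_of_bool _)%:R.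
  apply/eqP/forallP => [-> i|H]; first by rewrite ffunE.
  by apply/ffunP => i; rewrite ffunE; apply/negbTE/H.
apply: eq_bigr => i _; congr (_ * _).
rewrite -mulr_sumr (bigD1 i) //= {1}/bit_weight eqxx; congr (_ * _).
rewrite (eq_bigr (fun i' => (~~ col i')%:R)); last first.
  by move=> i' /negPf ii'; rewrite /bit_weight (inj_eq Some_inj) eq_sym ii'.
rewrite [RHS]big_mkcond [RHS](eq_bigr (fun i' => ((i' == i) || ~~ col i')%:R)) /=; last first.
  by move=> i' _; case: eqP.
rewrite prod_indicator big_bool /=.
have E b : (col == single_col i b) = (col i == b) && [forall i', (i' == i) || ~~ col i'].
  apply/eqP/andP => [->|[/eqP cb /forallP H]].
    rewrite ffunE eqxx /= eqxx; split=> //; apply/forallP => i'.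
    by rewrite ffunE; case: eqP.
  apply/ffunP => i'; rewrite ffunE; have [->//|ii'] := eqVneq i' i.
  by apply/negbTE; move: (H i'); rewrite (negPf ii').
by rewrite !E; case: (col i); rewrite /= ?addr0 ?add0r.
Qed.

Lemma D0E k n (nu : 'I_k -> R) (X : Input k n) :
  D0 nu X = \sum_D choices_weight nu D * \prod_i input_weight D i (X i).
Proof.
rewrite /D0; under eq_bigr do rewrite col_probE.
rewrite bigA_distr_bigA; apply: eq_bigr => D _; rewrite big_split /=; congr (_ * _).
rewrite exchange_big; apply: eq_bigr => i _; apply: eq_bigr => j _.
by rewrite ffunE.
Qed.

(** * Transcripts given the choices: Hellinger loss and error *)

Section ConditionedOnChoices.
Variables (k n : nat) (P : protocol k n).
Implicit Types (D : {ffun 'I_n -> option 'I_k}) (j : 'I_n) (i : 'I_k).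

(** The two transcript laws share the factors of the players other than [i], so the geometric mean
    of the leaf probabilities takes square roots only for player [i]. *)
Definition loss D j i : R :=
  1 - \sum_(l <- leaves P)
    Num.sqrt (cmass D j false i (l.1.1 i)) * Num.sqrt (cmass D j true i (l.1.1 i))
    * \prod_(i' | i' != i) cmass D j false i' (l.1.1 i').

Definition affinity D j : R :=
  \sum_(l <- leaves P) \prod_i
    (Num.sqrt (cmass D j false i (l.1.1 i)) * Num.sqrt (cmass D j true i (l.1.1 i))).

(** With [err1], the probabilities of a wrong output given [D] when column [j] is overwritten by
    zeros, respectively by ones. *)
Definition err0 D j : R :=
  \sum_(l <- leaves P) (l.2)%:R * \prod_i cmass D j false i (l.1.1 i).

Definition err1 D j : R :=
  \sum_(l <- leaves P) (~~ l.2)%:R * \prod_i cmass D j true i (l.1.1 i).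

(** Column [j] is overwritten, whoever holds its free bit; this independence produces the division
    by [nu i] in [mean_loss_le]. *)
Lemma loss_upd D j a i : loss (upd D j a) j i = loss D j i.
Proof.
congr (1 - _); apply: eq_bigr => l _; rewrite !cmass_upd; congr (_ * _).
by apply: eq_bigr => i' _; rewrite cmass_upd.
Qed.

(** Setting bit [j] of each player to 1 independently with probability [p] keeps the inputs
    independent; the identity is algebraic, hence valid for every real [p], as [hellinger_star]
    requires. *)
Lemma sum_leaves_cmass D j (p : R) :
  \sum_(l <- leaves P) \prod_i
    ((1 - p) * cmass D j false i (l.1.1 i) + p * cmass D j true i (l.1.1 i)) = 1.
Proof.
pose w i (z : BV n * bool) := input_weight D i z.1 * (if z.2 then p else 1 - p).
have := sum_leaves_prod P (fun z : BV n * bool => upd z.1 j z.2) w (fun=> 1).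
under [X in _ = X -> _]eq_bigr do rewrite mulr1.
rewrite sum_prodw [X in _ = X]big1 => [E|i _].
  apply: etrans E; apply: eq_bigr => l _; rewrite mul1r; apply: eq_bigr => i _.
  rewrite -(pair_bigA _ (fun x b => w i (x, b) * (upd x j b \in l.1.1 i)%:R)) /=.
  rewrite /cmass !mulr_sumr -big_split; apply: eq_bigr => x _ /=.
  by rewrite big_bool /w /=; ring.
rewrite -(pair_bigA _ (fun x b => w i (x, b))) /= -[RHS](sum_input_weight D i).
by apply: eq_bigr => x _; rewrite big_bool /w /=; ring.
Qed.

Lemma affinity_loss D j : 1 - affinity D j <= 4 * \sum_i loss D j i.
Proof.
pose a (l : leaf k n) i := Num.sqrt (cmass D j false i (l.1.1 i)).
pose b (l : leaf k n) i := Num.sqrt (cmass D j true i (l.1.1 i)).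
have a2 l i : a l i ^+ 2 = cmass D j false i (l.1.1 i) by rewrite sqr_sqrtr ?cmass_ge0.
have b2 l i : b l i ^+ 2 = cmass D j true i (l.1.1 i) by rewrite sqr_sqrtr ?cmass_ge0.
have H p : \sum_(l <- leaves P) \prod_i ((1 - p) * a l i ^+ 2 + p * b l i ^+ 2) = 1.
  apply: etrans (sum_leaves_cmass D j p); apply: eq_bigr => l _.
  by apply: eq_bigr => i _; rewrite a2 b2.
apply: le_trans (hellinger_star H) _; rewrite le_eqVlt; apply/orP; left; apply/eqP.
congr (_ * _); apply: eq_bigr => i _; congr (1 - _); apply: eq_bigr => l _.
by congr (_ * _); apply: eq_bigr => i' _; rewrite a2.
Qed.

(** For [m != 0], [x = m * (1 + b)] and [y = m * (1 - b)], so the right side is [m] times the root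
    of [1 - b ^+ 2], a number in [0, 1] and so at most its own root. *)
Lemma sqrt_mul_ge (x y m b : R) : 0 <= x -> 0 <= y ->
  m = 2^-1 * (x + y) -> b = 2^-1 * (x - y) / m ->
  m * (1 - b ^+ 2) <= Num.sqrt x * Num.sqrt y.
Proof.
move=> x0 y0 mE bE.
have [m0|m0] := eqVneq m 0; first by rewrite m0 mul0r mulr_ge0 ?sqrtr_ge0.
have mp : 0 < m by rewrite lt_def m0; lra.
have bm : b * m = 2^-1 * (x - y) by rewrite bE divfK.
have xE : x = m * (1 + b) by rewrite mulrDr mulr1 [m * b]mulrC bm; lra.
have yE : y = m * (1 - b) by rewrite mulrBr mulr1 [m * b]mulrC bm; lra.
have b1 : 0 <= 1 + b by move: x0; rewrite xE pmulr_rge0.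
have b2 : 0 <= 1 - b by move: y0; rewrite yE pmulr_rge0.
have b3 : 0 <= 1 - b ^+ 2.
  by have := mulr_ge0 b1 b2; congr (0 <= _); ring.
rewrite -sqrtrM // -[leLHS]ger0_norm ?mulr_ge0 ?(ltW mp) // -sqrtr_sqr.
apply: ler_wsqrtr.
have -> : x * y = m ^+ 2 * (1 - b ^+ 2) by rewrite xE yE; ring.
rewrite exprMn ler_wpM2l ?sqr_ge0 // expr2 ler_piMr //.
by have := sqr_ge0 b; lra.
Qed.

(** Under [D] the mass of player [i] is the mean of its two conditioned masses, while the others
    already have bit 0 at [j]; [sqrt_mul_ge] bounds the deficit of the geometric mean leaf by
    leaf. *)
Lemma loss_le_bias D j i : D j = Some i ->
  loss D j i <= \sum_(l <- leaves P)
    (\prod_i' mass D i' (l.1.1 i')) * bias D i (l.1.1 i) j ^+ 2.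
Proof.
move=> Dj; rewrite /loss -[X in X - _](sum_leaves_mass D P) -sumrB.
apply: ler_sum => l _; rewrite lerBlDr -lerBlDl -[X in X - _]mulr1 -mulrBr.
rewrite (bigD1 i) //=.
rewrite (eq_bigr (fun i' => cmass D j false i' (l.1.1 i'))); last first.
  move=> i' /negPf ii'; rewrite (mass_cmass D j) Dj (inj_eq Some_inj) eq_sym ii' //.
rewrite mulrAC; apply: ler_wpM2r.
  by apply: prodr_ge0 => *; apply: cmass_ge0.
apply: sqrt_mul_ge; rewrite ?cmass_ge0 //.
  by rewrite (mass_cmass D j) Dj eqxx.
exact: bias_cmass.
Qed.

Lemma sum_loss_le D i cb : bounded cb P ->
  \sum_(j | D j == Some i) loss D j i <= 8 * (cb i)%:R.
Proof.
move=> /(sum_bias_le D i); apply: le_trans.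
apply: (@le_trans _ _ (\sum_(j | D j == Some i) \sum_(l <- leaves P)
    (\prod_i' mass D i' (l.1.1 i')) * bias D i (l.1.1 i) j ^+ 2)).
  by apply: ler_sum => j /eqP; apply: loss_le_bias.
rewrite exchange_big le_eqVlt; apply/orP; left; apply/eqP.
by apply: eq_bigr => l _; rewrite mulr_sumr.
Qed.

(** On each leaf [x * y <= 5 / 2 * x ^+ 2 + 10^-1 * y ^+ 2], where [x ^+ 2] is the leaf's
    probability under the column for which its output is wrong; the large coefficient thus falls on
    the error. *)
Lemma affinity_le D j : affinity D j <= 5^-1 + 5 / 2 * (err0 D j + err1 D j).
Proof.
pose A (l : leaf k n) := \prod_i cmass D j false i (l.1.1 i).
pose B (l : leaf k n) := \prod_i cmass D j true i (l.1.1 i).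
have A1 : \sum_(l <- leaves P) A l = 1.
  apply: etrans (sum_leaves_cmass D j 0); apply: eq_bigr => l _.
  by apply: eq_bigr => i _; ring.
have B1 : \sum_(l <- leaves P) B l = 1.
  apply: etrans (sum_leaves_cmass D j 1); apply: eq_bigr => l _.
  by apply: eq_bigr => i _; ring.
have -> : 5^-1 + 5 / 2 * (err0 D j + err1 D j) = \sum_(l <- leaves P)
    (10^-1 * (A l + B l) + 5 / 2 * (l.2%:R * A l + (~~ l.2)%:R * B l)).
  rewrite big_split -!mulr_sumr !big_split /= A1 B1 /err0 /err1.
  by congr (_ + _); field.
apply: ler_sum => l _.
set a := \prod_i Num.sqrt (cmass D j false i (l.1.1 i)).
set b := \prod_i Num.sqrt (cmass D j true i (l.1.1 i)).
have -> : A l = a ^+ 2.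
  rewrite -prodrXl; apply: eq_bigr => i _; by rewrite sqr_sqrtr ?cmass_ge0.
have -> : B l = b ^+ 2.
  rewrite -prodrXl; apply: eq_bigr => i _; by rewrite sqr_sqrtr ?cmass_ge0.
rewrite big_split /= -/a -/b.
have h1 := sqr_ge0 (5 * a - b); have h2 := sqr_ge0 (5 * b - a).
have h3 := sqr_ge0 a; have h4 := sqr_ge0 b.
move: h1 h2; rewrite !sqrrB !exprMn.
by case: (l.2); rewrite /= ?mul1r ?mul0r ?addr0 ?add0r; lra.
Qed.

(** Whatever the choice for column [j], this column is zero with probability at least 1/2, so
    forcing it to zero at most doubles the error. *)
Lemma mean_err0 (nu : 'I_k -> R) j : subdistr nu ->
  \sum_D choices_weight nu D * err0 D j
  <= 2 * \sum_(X : Input k n) D0 nu X * (run P X != false)%:R.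
Proof.
move=> nuP.
pose acc D := \sum_(l <- leaves P) (l.2)%:R * \prod_i mass D i (l.1.1 i).
have -> : \sum_(X : Input k n) D0 nu X * (run P X != false)%:R
    = \sum_D choices_weight nu D * acc D.
  under eq_bigr => X _ do rewrite D0E mulr_suml.
  rewrite exchange_big; apply: eq_bigr => D _ /=.
  under eq_bigr => X _ do rewrite -mulrA.
  rewrite -mulr_sumr; congr (_ * _).
  rewrite /acc (sum_leaves_prod P id (input_weight D) (fun b => b%:R)).
  apply: eq_bigr => X _; congr (_ * _%:R).
  have -> : [ffun i => id (X i)] = X by apply/ffunP => i; rewrite ffunE.
  by case: (run P X).
rewrite /choices_weight (prodw_resample (j := j) acc) ?sum_choice_weight //.
rewrite mulr_sumr; apply: ler_sum => D _; rewrite mulrCA.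
apply: ler_wpM2l; first exact: choices_weight_ge0.
have half a : 2^-1 * err0 D j <= acc (upd D j a).
  rewrite mulr_sumr; apply: ler_sum => l _; rewrite mulrCA.
  apply: ler_wpM2l; first exact: ler0n.
  case: a => [i0|]; last first.
    rewrite [leRHS](eq_bigr (fun i => cmass D j false i (l.1.1 i))); last first.
      by move=> i _; rewrite (mass_cmass _ j) upd_eq /= cmass_upd.
    apply: ler_piMl; last by lra.
    by apply: prodr_ge0 => *; apply: cmass_ge0.
  rewrite (bigD1 i0) //= [leRHS](bigD1 i0) //= mulrA.
  rewrite [X in _ <= _ * X](eq_bigr (fun i => cmass D j false i (l.1.1 i))); last first.
    move=> i /negPf ii0.
    by rewrite (mass_cmass _ j) upd_eq (inj_eq Some_inj) eq_sym ii0 cmass_upd.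
  apply: ler_wpM2r; first by apply: prodr_ge0 => *; apply: cmass_ge0.
  rewrite (mass_cmass _ j) upd_eq eqxx !cmass_upd mulrDr lerDl.
  by rewrite mulr_ge0 ?cmass_ge0 ?invr_ge0.
rewrite -(ler_pM2l (_ : 0 < 2^-1)) ?invr_gt0 // [leRHS]mulrA mulVf ?pnatr_eq0 // mul1r.
rewrite -[leLHS]mul1r -[X in X * _ <= _](sum_choice_weight nu) mulr_suml.
by apply: ler_sum => a _; apply: ler_wpM2l (half a); apply: choice_weight_ge0.
Qed.

(** [D1] plants its column at a uniform position independent of [X], so the sum over [j] is exactly
    [n] times the average. *)
Lemma mean_err1 (nu : 'I_k -> R) : (0 < n)%N ->
  \sum_j \sum_D choices_weight nu D * err1 D j
  = n%:R * \sum_(X : Input k n) D1 nu X * (run P X != true)%:R.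
Proof.
move=> n0.
transitivity (\sum_j \sum_(X : Input k n) D0 nu X * (~~ run P (set_col X j))%:R).
  apply: eq_bigr => j _.
  under [RHS]eq_bigr => X _ do rewrite D0E mulr_suml.
  rewrite exchange_big; apply: eq_bigr => D _ /=.
  under [RHS]eq_bigr => X _ do rewrite -mulrA.
  rewrite -mulr_sumr; congr (_ * _).
  rewrite /err1 (sum_leaves_prod P (fun x => upd x j true) (input_weight D)
    (fun b => (~~ b)%:R)).
  by apply: eq_bigr => X _; congr (_ * (~~ run P _)%:R).
rewrite /D1.
under [in RHS]eq_bigr => Y _ do rewrite mulr_suml.
rewrite [in RHS]exchange_big mulr_sumr exchange_big; apply: eq_bigr => X _ /=.
under [in RHS]eq_bigr => Y _ do rewrite mulr_suml.
rewrite exchange_big mulr_sumr; apply: eq_bigr => j _ /=.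
rewrite (bigD1 (set_col X j)) //= eqxx big1 => [|Y /negPf->]; last first.
  by rewrite mulr0 mul0r.
rewrite addr0 mulr1 mulrA mulrCA mulfV ?mulr1 ?pnatr_eq0 -?lt0n //.
by case: (run P _).
Qed.
End ConditionedOnChoices.

(** * Averaging over the choices and the final bound *)

(** As [loss P D j i] does not depend on [D j], multiplying its mean by [nu i] restricts the average
    to [D j = Some i], where [sum_loss_le] applies. *)
Lemma mean_loss_le (k n : nat) (P : protocol k n) (nu : 'I_k -> R) cb i :
  subdistr nu -> bounded cb P -> (nu i == 0 -> cb i == 0%N) ->
  \sum_j \sum_D choices_weight nu D * loss P D j i
  <= 8 * (if nu i == 0 then 0 else (cb i)%:R / nu i).
Proof.
move=> nuP Pcb; case: eqP => [_ /(_ isT)/eqP c0|/eqP nui _].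
  rewrite mulr0; apply: sumr_le0 => j _; apply: sumr_le0 => D _.
  (* Here [nu i = 0], so the silent player [i] is made the holder of [j] by hand; [sum_bias_le] with
     bound 0 then makes the loss nonpositive. *)
  rewrite -(loss_upd P D j (Some i)); apply: mulr_ge0_le0.
    exact: choices_weight_ge0.
  apply: le_trans (loss_le_bias P (upd_eq D j (Some i))) _.
  have := sum_bias_le (upd D j (Some i)) i Pcb; rewrite c0 mulr0; apply: le_trans.
  apply: ler_sum => l _; rewrite [X in _ <= _ * X](bigD1 j) /= ?upd_eq // mulrDr lerDl.
  rewrite mulr_ge0 ?sumr_ge0 //; first by apply: prodr_ge0 => *; apply: mass_ge0.
  by move=> *; apply: sqr_ge0.
have nu0 : 0 < nu i by rewrite lt_def nui; case: nuP => ->.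
rewrite mulrA ler_pdivlMr // mulr_suml.
have E j : (\sum_D choices_weight nu D * loss P D j i) * nu i =
    \sum_D choices_weight nu D * ((D j == Some i)%:R * loss P D j i).
  rewrite /choices_weight [RHS](prodw_resample (j := j) (fun D =>
    (D j == Some i)%:R * loss P D j i)) ?sum_choice_weight // mulr_suml.
  apply: eq_bigr => D _; rewrite -mulrA; congr (_ * _).
  rewrite (bigD1 (Some i)) //= upd_eq eqxx mul1r loss_upd big1 ?addr0 1?mulrC //.
  by move=> a /negPf ai; rewrite upd_eq ai mul0r mulr0.
under eq_bigr do rewrite E.
rewrite exchange_big /=.
rewrite -[leRHS]mul1r -[X in _ <= X * _](sum_choices_weight n nu) mulr_suml.
apply: ler_sum => D _; rewrite -mulr_sumr; apply: ler_wpM2l.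
  exact: choices_weight_ge0.
apply: le_trans (sum_loss_le D i Pcb).
rewrite [leRHS]big_mkcond; apply: ler_sum => j _.
by case: eqP; rewrite ?mul1r ?mul0r.
Qed.

Lemma D1_ge0 k n (nu : 'I_k -> R) (Y : Input k n) : subdistr nu -> 0 <= D1 nu Y.
Proof.
move=> nuP; apply: sumr_ge0 => X _; apply: sumr_ge0 => j _.
rewrite !mulr_ge0 ?invr_ge0 ?ler0n // D0E; apply: sumr_ge0 => D _.
rewrite mulr_ge0 ?choices_weight_ge0 //; apply: prodr_ge0 => i _.
exact: input_weight_ge0.
Qed.

(** The error bound means [E0 + E1 <= 4 / 100], so [M (err0 P) + M (err1 P) <= 8 / 100 * n] and the
    total of [1 - affinity] is at least [3 / 5 * n]. It is at most 32 times the cost, and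
    [3 / 5 / 32 >= 100^-1]. *)
Lemma sum_cost_ge (k n : nat) (P : protocol k n) (nu : 'I_k -> R) cb :
  (0 < n)%N -> subdistr nu -> bounded cb P ->
  (forall i, nu i == 0 -> cb i == 0%N) -> error nu P <= 2%:R / 100%:R ->
  100^-1 * n%:R <= \sum_i (if nu i == 0 then 0 else (cb i)%:R / nu i).
Proof.
move=> n0 nuP Pcb c0; rewrite /error.
set E0 := \sum_X D0 _ _ * _; set E1 := \sum_X D1 _ _ * _ => err.
have E1_0 : 0 <= E1 by apply: sumr_ge0 => Y _; rewrite mulr_ge0 ?D1_ge0.
pose M (f : {ffun 'I_n -> option 'I_k} -> 'I_n -> R) :=
  \sum_j \sum_D choices_weight nu D * f D j.
have Mle f g : (forall D j, f D j <= g D j) -> M f <= M g.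
  move=> fg; apply: ler_sum => j _; apply: ler_sum => D _.
  by apply: ler_wpM2l (fg _ _); apply: choices_weight_ge0.
have MD f g : M (fun D j => f D j + g D j) = M f + M g.
  rewrite /M -big_split; apply: eq_bigr => j _; rewrite -big_split.
  by apply: eq_bigr => D _; rewrite mulrDr.
have MZ x f : M (fun D j => x * f D j) = x * M f.
  rewrite /M mulr_sumr; apply: eq_bigr => j _; rewrite mulr_sumr.
  by apply: eq_bigr => D _; rewrite mulrCA.
have Mcst x : M (fun _ _ => x) = n%:R * x.
  rewrite /M; under eq_bigr do rewrite -mulr_suml sum_choices_weight mul1r.
  by rewrite sumr_const card_ord mulr_natl.
have Msum f : M (fun D j => \sum_i f i D j) = \sum_i M (f i).
  rewrite /M [RHS]exchange_big; apply: eq_bigr => j _; rewrite [RHS]exchange_big.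
  by apply: eq_bigr => D _; rewrite mulr_sumr.
have upper : M (fun D j => 1 - affinity P D j) <=
    32 * \sum_i (if nu i == 0 then 0 else (cb i)%:R / nu i).
  apply: le_trans (Mle _ _ (affinity_loss P)) _.
  rewrite MZ Msum -[32]/(4 * 8)%:R natrM -mulrA ler_wpM2l // mulr_sumr.
  by apply: ler_sum => i _; apply: mean_loss_le (c0 i).
have lower : 4 / 5 * n%:R <= M (fun D j => 1 - affinity P D j)
    + 5 / 2 * (M (err0 P) + M (err1 P)).
  rewrite -MD -MZ -MD -[4 / 5 * _]mulrC -Mcst; apply: Mle => D j.
  by have := affinity_le P D j; lra.
have m0 : M (err0 P) <= n%:R * (2 * E0).
  rewrite -[n%:R]/(n%:R) mulr_natl -{2}[n]card_ord -sumr_const.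
  by apply: ler_sum => j _; apply: mean_err0.
have m1 : M (err1 P) = n%:R * E1 by apply: mean_err1.
have nn : 0 < n%:R :> R by rewrite ltr0n.
set S := \sum_i _ in upper *.
have : n%:R * (E0 + E1) <= n%:R * (4 / 100) by rewrite ler_pM2l //; lra.
have : 0 <= n%:R * E1 by rewrite mulr_ge0 // ltW.
by rewrite m1 in lower; lra.
Qed.

Theorem mainTheorem7 :
  exists c : R, 0 < c /\
    forall (n k : nat), (1 <= n)%N -> (2 <= k)%N ->
    forall (nu : 'I_k -> R), subdistr nu ->
    forall (cb : 'I_k -> nat) (P : protocol k n),
      bounded cb P ->
      error nu P <= 2%:R / 100%:R ->
      ((c * n%:R)%:E <= \sum_(i < k) cost_ratio cb nu i)%E.
Proof.
exists (100^-1); split; first by rewrite invr_gt0.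
move=> n k n1 _ nu nuP cb P Pcb err.
have ratio_ge0 i : (0 <= cost_ratio cb nu i)%E.
  rewrite /cost_ratio; case: ifP => _; first by case: ifP; rewrite ?lexx ?leey.
  by rewrite lee_fin divr_ge0 //; case: nuP => ->.
case: (boolP [forall i, (nu i == 0) ==> (cb i == 0%N)]) => [/forallP c0|].
  rewrite (eq_bigr (fun i => (if nu i == 0 then 0 else (cb i)%:R / nu i)%:E)).
    rewrite sumEFin lee_fin; apply: (sum_cost_ge n1 nuP Pcb) err => i.
    exact/implyP.
  move=> i _; rewrite /cost_ratio; move: (c0 i).
  by case: eqP => //= _ ->.
(* One term is infinite here; the others are nonnegative, so their sum is not [-oo]. *)
rewrite negb_forall => /existsP[i]; rewrite negb_imply => /andP[nui ci].
rewrite (bigD1 i) //= {1}/cost_ratio nui (negPf ci) addye ?leey //.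
by rewrite gt_eqF // (lt_le_trans ltNy0) // sume_ge0.
Qed.
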